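(* Let $n\ge 1$ be an integer and let $p\in[1,\infty)$. Let $B^{l^p(n)}_1=\{x\in\mathbb{R}^n : (\sum_i |x_i|^p)^{1/p}\le 1\}$, regarded as a metric space with the $l^\infty$ metric $d(x,y)=\max_i|x_i-y_i|$. Then $\mathrm{wspec}(B^{l^p(n)}_1,l^\infty)=\{0,1,\ldots,n\}$, and for every real $\varepsilon>0$, \[ \mathrm{wdim}_\varepsilon(B^{l^p(n)}_1,l^\infty)=\begin{cases}0 & \text{if } 2\le\varepsilon,\\ k & \text{if } 2(k+1)^{-1/p}\le\varepsilon<2k^{-1/p},\quad k\in\{1,\ldots,n-1\},\\ n & \text{if }\varepsilon<2n^{-1/p}.\end{cases} \]
   Context: For a metric space $(X,d)$ and $\varepsilon>0$, an $\varepsilon$-embedding is a continuous map $f:X\to Y$ such that $\mathrm{Diam} f^{-1}(y)\le\varepsilon$ for all $y\in Y$. $\mathrm{wdim}_\varepsilon(X,d)$ is the smallest integer $k$ such that there exists an $\varepsilon$-embedding of $X$ into a $k$-dimensional polyhedron $K$ ($+\infty$ if there is none). $\mathrm{wspec}(X,d)\subset\mathbb{Z}_{\ge0}\cup\{+\infty\}$ is the set of values taken by the map $\varepsilon\mapsto\mathrm{wdim}_\varepsilon(X,d)$, $\varepsilon\in\mathbb{R}_{>0}$. *)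

(* Defs.v *)
From HB Require Import structures.
From mathcomp Require Import all_boot all_order all_algebra finmap.
From mathcomp Require Import all_classical all_reals all_analysis.
Set Implicit Arguments.
Unset Strict Implicit.
Unset Printing Implicit Defensive.

Import Order.TTheory GRing.Theory Num.Theory numFieldNormedType.Exports.
Local Open Scope classical_set_scope.
Local Open Scope ring_scope.

Section row_vector_metric.
Context {R : realType} {n : nat}.
Implicit Types x y : 'rV[R]_n.

(* The norm of 'rV[R]_n is the maximum of the absolute values of the
   coordinates, so this is the l^oo metric. *)
Let dist x y : R := `|x - y|.

Let dist_ge0 x y : 0 <= dist x y. Proof. exact: normr_ge0. Qed.

Let dist_positivity x y : dist x y = 0 -> x = y.
Proof. by move=> /normr0_eq0/subr0_eq. Qed.

Let ballE x (d : R) : ball x d = [set y | dist x y < d].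
Proof. by rewrite -ball_normE. Qed.

HB.instance Definition _ := @PseudoMetric_isMetric.Build R 'rV[R]_n
  dist dist_ge0 dist_positivity ballE.

End row_vector_metric.

Section subset_metric.
Context {R : realType} {T : metricType R} (A : set T).

Let dist (x y : A) : R := mdist (set_val x) (set_val y).

Let dist_ge0 x y : 0 <= dist x y. Proof. exact: mdist_ge0. Qed.

Let dist_positivity x y : dist x y = 0 -> x = y.
Proof. by move=> /mdist_positivity/val_inj. Qed.

Let ballE (x : A) (d : R) : ball x d = [set y | dist x y < d].
Proof.
rewrite /dist -[LHS]/([set y | ball (set_val x) d (set_val y)]).
by rewrite ballEmdist.
Qed.

HB.instance Definition _ := @PseudoMetric_isMetric.Build R (set_type A)
  dist dist_ge0 dist_positivity ballE.

End subset_metric.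

(* An element of V that belongs to no simplex is not a vertex of the complex. *)
Record simplicial_complex (V : choiceType) := SimplicialComplex {
  simplex :> {fset V} -> Prop ;
  simplex_neq0 : forall s, simplex s -> s != fset0 ;
  simplex_sub : forall s t : {fset V},
    simplex s -> (t `<=` s)%fset -> t != fset0 -> simplex t
}.

Definition complex_has_dim (V : choiceType) (K : simplicial_complex V)
    (k : nat) : Prop :=
  (exists2 s, K s & #|` s| = k.+1) /\ (forall s, K s -> #|` s| <= k.+1)%N.

Section polyhedron.
Context (R : realType) (V : choiceType).

(* points are given by their barycentric coordinates *)
Definition closed_simplex (s : {fset V}) : set (V -> R) :=
  [set a | [/\ forall v, 0 <= a v, forall v, v \notin s -> a v = 0
             & \sum_(v <- s) a v = 1]].

Record polyhedron (K : simplicial_complex V) := Polyhedron {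
  bary :> V -> R ;
  baryP : exists2 s, K s & closed_simplex s bary
}.

Variable K : simplicial_complex V.

HB.instance Definition _ := gen_eqMixin (polyhedron K).
HB.instance Definition _ := gen_choiceMixin (polyhedron K).

(* The coherent (Whitehead) topology: a set is open iff its trace on each
   closed simplex is open for the Euclidean topology of that simplex. *)
Definition polyhedron_open : set_system (polyhedron K) :=
  [set U | forall (s : {fset V}) (a : polyhedron K),
    K s -> U a -> closed_simplex s a ->
    exists2 e : R, 0 < e & forall b : polyhedron K, closed_simplex s b ->
      (forall v, `|a v - b v| < e) -> U b].

Let polyhedron_openT : polyhedron_open setT.
Proof. by move=> s a _ _ _; exists 1. Qed.

Let polyhedron_openI : setI_closed polyhedron_open.
Proof.
move=> U W oU oW s a Ks [Ua Wa] sa.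
have [e e0 eU] := oU s a Ks Ua sa; have [d d0 dW] := oW s a Ks Wa sa.
exists (Num.min e d); first by rewrite lt_min e0.
move=> b sb ab; split.
  by apply: eU => // v; have := ab v; rewrite lt_min => /andP[].
by apply: dW => // v; have := ab v; rewrite lt_min => /andP[].
Qed.

Let polyhedron_open_bigU (I : Type) (U : I -> set (polyhedron K)) :
  (forall i, polyhedron_open (U i)) -> polyhedron_open (\bigcup_i U i).
Proof.
move=> oU s a Ks [i _ Uia] sa; have [e e0 eU] := oU i s a Ks Uia sa.
by exists e => // b sb ab; exists i => //; exact: eU.
Qed.

HB.instance Definition _ := isOpenTopological.Build (polyhedron K)
  polyhedron_openT polyhedron_openI polyhedron_open_bigU.

End polyhedron.

Section width_dimension.
Context {R : realType}.

(* 0 is added to the set so that the diameter of the empty set is 0 *)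
Definition diam {X : metricType R} (A : set X) : \bar R :=
  ereal_sup (0%E |` [set (mdist x y)%:E | x in A & y in A]).

Definition eps_embedding {X : metricType R} {Y : topologicalType} (eps : R)
    (f : X -> Y) : Prop :=
  continuous f /\ forall y, (diam (f @^-1` [set y]) <= eps%:E)%E.

Definition eps_embeds_in_dim (X : metricType R) (eps : R) (k : nat) : Prop :=
  exists (V : choiceType) (K : simplicial_complex V) (f : X -> polyhedron R K),
    complex_has_dim K k /\ eps_embedding eps f.

Definition wdim (X : metricType R) (eps : R) : \bar nat :=
  if pselect (exists k, `[< eps_embeds_in_dim X eps k >]) is left exk
  then (ex_minn exk)%:E else +oo%E.

Definition wspec (X : metricType R) : set (\bar nat) :=
  [set wdim X eps | eps in [set eps : R | 0 < eps]].

Definition lp_ball (n : nat) (p : R) : set 'rV[R]_n :=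
  [set x | (\sum_i `|x ord0 i| `^ p) `^ p^-1 <= 1].

Definition lp_ball_linfty (n : nat) (p : R) : metricType R :=
  set_type (@lp_ball n p).

End width_dimension.

Arguments lp_ball_linfty {R} n p.

(* Main.v *)
(** With r = eps/2, soft thresholding at r (which moves each coordinate towards
    0 by r) has fibres of diameter at most eps, and a point of the unit l^p ball
    has at most k coordinates of absolute value greater than r as soon as
    (k+1)^(-1/p) <= r. This maps the ball into the k-skeleton of a simplex.

    Conversely, the ball contains the cube [-a, a]^k with a = k^(-1/p), and a
    continuous map from this cube to a polyhedron of dimension less than k
    identifies two points of opposite faces. Otherwise, the distances to the
    images of the k negative faces give a 1-Lipschitz map G from the image to
    R^k; as the image has dimension less than k, G misses a ball around some
    point c close to the centre, although G - c changes sign between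
    opposite faces, against the Poincare-Miranda theorem. The latter follows
    from a discrete version, obtained by evaluating modulo 2 a product of
    1-cocycles on a cubical torus with an odd number of vertices. *)

From HB Require Import structures.
Require Import Defs.
From mathcomp Require Import all_boot all_order all_algebra.
From mathcomp Require Import all_classical all_reals all_analysis.
From mathcomp Require Import finmap zify ring lra.
Import Order.TTheory GRing.Theory Num.Theory numFieldNormedType.Exports.
Local Open Scope classical_set_scope.
Local Open Scope ring_scope.

Set Implicit Arguments.
Unset Strict Implicit.
Unset Printing Implicit Defensive.

(** * Cochains modulo 2 and cubical cup products *)

Lemma sum_offdiag_sym (I : finType) (S : {set I}) (f : I -> I -> bool) :
  (forall i j, f i j = f j i) ->
  \sum_(i in S) \sum_(j in S :\ i) f i j = 0.
Proof.
move=> fC.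
(* Addition in [bool] is exclusive or, so the ordered pairs above the diagonal cancel their mirror
   images. *)
rewrite pair_big_dep /= (bigID (fun q => (enum_rank q.1 < enum_rank q.2)%N)) /=.
set A := (X in X + _); set B := (X in _ + X).
suff -> : B = A by rewrite /GRing.add /=; case: A.
rewrite /A /B (reindex_inj (h := fun q : I * I => (q.2, q.1))) /=; last first.
  by move=> [a b] [c d] [-> ->].
apply: eq_big => [[i j]|[i j] _] /=; last exact: fC.
rewrite !inE -leqNgt leq_eqVlt (inj_eq (inj_comp val_inj enum_rank_inj)).
by rewrite eq_sym; case: eqP => [->|] /=; rewrite ?ltnn ?andbF //; case: (i \in S); case: (j \in S); case: ltnP.
Qed.

Section cup_product.
Variables (G : finZmodType) (I : finType) (e : I -> G) (a : I -> G -> I -> bool).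

(* The cubical cup product, modulo 2, of the 1-cochains [a l] for [l] in [ls],
   evaluated on the cube with base point x and edge directions in S. *)
Fixpoint cup (ls : seq I) (S : {set I}) (x : G) : bool :=
  if ls is l :: ls' then \sum_(j in S) a l x j * cup ls' (S :\ j) (x + e j)
  else 1.

(** A nonzero sum has a nonzero term. Such a term is a monotone edge path from [x] with every factor
    nonzero on its own edge; [T] collects the directions used before the edge of the factor [l]. *)
Lemma cup_path ls S x l : cup ls S x -> l \in ls ->
  exists (T : {set I}) (j : I), j \notin T /\ a l (x + \sum_(i in T) e i) j.
Proof.
suff: cup ls S x -> l \in ls -> exists (T : {set I}) (j : I),
  [/\ T \subset S, j \notin T, j \in S & a l (x + \sum_(i in T) e i) j].
  by move=> + H1 H2 => /(_ H1 H2) [T [j [_ ? _ ?]]]; exists T, j.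
elim: ls S x => // l' ls IH S x /= + ll.
have [[j /andP[jS /andP[aj cj]]] _|H] :=
  pselect (exists j, (j \in S) && (a l' x j && cup ls (S :\ j) (x + e j))); last first.
  rewrite big1 // => j jS; apply/negbTE/negP => C; apply: H; exists j.
  by rewrite jS.
move: ll; rewrite inE => /predU1P[->|lls].
  by exists finset.set0, j; rewrite finset.sub0set inE big_set0 addr0.
have [T [i [TS iT iS ai]]] := IH _ _ cj lls.
have jT : j \notin T by apply/negP => /(fintype.subsetP TS); rewrite !inE eqxx.
exists (j |: T)%SET, i; split.
- by rewrite finset.subUset finset.sub1set jS (fintype.subset_trans TS) // finset.subsetDl.
- by rewrite !inE negb_or iT andbT; case/setD1P: iS.
- by case/setD1P: iS.
- by rewrite big_setU1 //= addrA.
Qed.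

Hypothesis a_closed : forall l x i j,
  a l x i + a l (x + e i) j = a l x j + a l (x + e j) i.

(** A cup product of cocycles is a cocycle: far and near facets of a cube have the same sum. The
    induction hypothesis moves the remaining factors to the far corner of [i] and [j]; what is left
    is symmetric in [i] and [j] by [a_closed], hence cancels. *)
Lemma cup_closed ls (S : {set I}) x :
  \sum_(j in S) cup ls (S :\ j) (x + e j) = \sum_(j in S) cup ls (S :\ j) x.
Proof.
elim: ls S x => [//|l ls IH] S x /=.
have -> : \sum_(i in S) \sum_(j in S :\ i) a l x j * cup ls (S :\ i :\ j) (x + e j)
    = \sum_(i in S) \sum_(j in S :\ i)
        a l x i * cup ls (S :\ i :\ j) (x + e i + e j).
  rewrite (exchange_big_dep (mem S)) /=; last by move=> i j; rewrite !inE => _ /andP[].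
  apply: eq_bigr => i iS; rewrite -[RHS]mulr_sumr IH mulr_sumr.
  apply: eq_big => [j|j _]; first by rewrite !inE iS andbT eq_sym andbC.
  by rewrite !finset.setDDl finset.setUC.
apply/eqP; rewrite -subr_eq0 -sumrB; apply/eqP.
under eq_bigr do rewrite -sumrB.
rewrite (_ : \sum_(i in S) _ = \sum_(i in S) \sum_(j in S :\ i)
  (a l (x + e i) j + a l x i) * cup ls (S :\: [set i; j]) (x + e i + e j)).
  apply: sum_offdiag_sym => i j; rewrite (finset.setUC [set i]%SET).
  by rewrite (addrAC x (e i)) (addrC (a _ _ j)) a_closed (addrC (a _ x j)).
apply: eq_bigr => i _; apply: eq_bigr => j _.
by rewrite finset.setDDl mulrDl; congr (_ + _); rewrite /GRing.opp.
Qed.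
End cup_product.

Lemma sum_shift (G : finZmodType) (y : G) (F : G -> bool) :
  \sum_x F (x + y) = \sum_x F x.
Proof. by rewrite [RHS](reindex_inj (addIr y)). Qed.

(* Modifying the constant cochains [j == l] by coboundaries does not change
   the value of their cup product on the fundamental class. *)
Lemma cup_total (G : finZmodType) (I : finType) (e : I -> G) (h : I -> G -> bool)
    (a := fun l x j => h l (x + e j) + h l x + (j == l)) ls :
  uniq ls -> \sum_x cup e a ls [set:: ls]%SET x = odd #|G|.
Proof.
have aC l x i j : a l x i + a l (x + e i) j = a l x j + a l (x + e j) i.
  rewrite /a (addrAC x (e j)).
  move: (h l x) (h l (x + e i)) (h l (x + e j)) (h l (x + e i + e j)) (i == l) (j == l).
  by do 6 case.
elim: ls => [_|l ls IH] /=.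
  by rewrite sumr_const; elim: #|G| => // n; rewrite mulrS => ->.
case/andP => lls uls; rewrite exchange_big /=.
under eq_bigr do under eq_bigr do rewrite /a !mulrDl.
under eq_bigr do rewrite !big_split /=.
rewrite big_split /=.
(* [X] is the coboundary part. Summation by parts turns it into [h l] times the coboundary of the
   remaining product, which vanishes by [cup_closed]. *)
set X := (X in X + _); suff -> : X = 0.
  rewrite add0r (bigD1 l) ?inE ?eqxx //= [X in _ + X]big1 ?addr0; last first.
    by move=> i /andP[_ /negbTE ->]; rewrite big1 // => x _; rewrite mul0r.
  under eq_bigr do rewrite mul1r.
  rewrite sum_shift -IH //; apply: eq_bigr => x _; congr (cup _ _ _ _ _).
  by apply/finset.setP => i; rewrite !inE; case: eqP => // ->; rewrite (negbTE lls).
rewrite /X big_split /=.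
under eq_bigr => j _ do
  rewrite (sum_shift (e j) (fun x => h l x * cup e a ls ([set:: l :: ls]%SET :\ j) x)).
rewrite exchange_big [X in _ + X]exchange_big /= -big_split big1 //= => x _.
by rewrite -!mulr_sumr cup_closed // -mulrDr /GRing.mul /= /GRing.add /= addbb andbF.
Qed.

(** * The discrete Poincare-Miranda theorem on a cubical torus *)

HB.instance Definition _ (I : finType) (V : finZmodType) :=
  GRing.Zmodule.on {ffun I -> V}.

Section grid.
Variables (N : nat) (I : finType).
Implicit Types x y : {ffun I -> 'I_N.+1}.

Let e (i : I) : {ffun I -> 'I_N.+1} := [ffun l => inord (l == i)].

Let translateE x (T : {set I}) l :
  (x + \sum_(i in T) e i) l = x l + inord (l \in T) :> 'I_N.+1.
Proof.
rewrite !ffunE sum_ffunE; congr (_ + _).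
have [lT|lT] := boolP (l \in T).
  rewrite (bigD1 l) //= ffunE eqxx big1 ?addr0 // => i /andP[_].
  by rewrite ffunE eq_sym => /negbTE ->; apply: val_inj; rewrite /= inordK.
rewrite big1 => [|i iT].
  by apply: val_inj; rewrite /= inordK.
rewrite ffunE; case: eqP => [li|_]; last by apply: val_inj; rewrite /= inordK.
by rewrite li iT in lT.
Qed.

Hypotheses (N_gt0 : (0 < N)%N) (N_even : ~~ odd N).

Let val_inord (b : bool) : (inord b : 'I_N.+1) = b :> nat.
Proof. by rewrite inordK //; case: b; rewrite ltnS. Qed.

Let translateN x (T : {set I}) l :
  (x + \sum_(i in T) e i) l = ((x l + (l \in T)) %% N.+1)%N :> nat.
Proof. by rewrite translateE /GRing.add /= val_inord. Qed.

(** Since [N] is even, the torus has an odd number of vertices, and [cup_total] gives a cube with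
    nonzero product. On an edge that does not wrap around, the parity in [h] cancels the term
    [j == l], so [a l] detects a change of [s l]; [cup_path] finds such an edge for every [l]. *)
Lemma discrete_poincare_miranda (s : I -> {ffun I -> 'I_N.+1} -> bool) :
  (forall l x, x l = 0%N :> nat -> ~~ s l x) ->
  (forall l x, x l = N :> nat -> s l x) ->
  exists x, forall l, exists y y', [/\ s l y, ~~ s l y' &
    forall i, (x i <= y i <= (x i).+1)%N /\ (x i <= y' i <= (x i).+1)%N].
Proof.
move=> s0 sN.
pose h l x := s l x (+) odd (x l).
pose a l x j := h l (x + e j) + h l x + (j == l).
have [x cx] : exists x, cup e a (enum I) [set:: enum I]%SET x.
  apply: contrapT => nex.
  have := cup_total e h (enum_uniq I); rewrite card_ffun card_ord oddX /= N_even orbT.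
  rewrite big1 // => x _; apply/negbTE/negP => cx.
  by apply: nex; exists x.
have path l : exists (T : {set I}) (j : I),
    j \notin T /\ a l (x + \sum_(i in T) e i) j.
  by apply: cup_path cx _; rewrite mem_enum.
have translateS (T : {set I}) j : j \notin T ->
    x + \sum_(i in T) e i + e j = x + \sum_(i in (j |: T)%SET) e i.
  by move=> jT; rewrite big_setU1 //= addrA addrAC.
(* The cube does not wrap around: if [x l] were [N], then [a l] would vanish on all its edges.
   Across a wrapping edge, the change of [s l] cancels the term [j == l]; any other edge keeps the
   coordinate [l] at [0] or at [N]. *)
have ltN l : (x l < N)%N.
  rewrite ltn_neqAle -ltnS ltn_ord andbT; apply/negP => /eqP xl.
  have [T [j [jT]]] := path l; rewrite /a /h translateS //.
  have [jl|jl] := eqVneq j l.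
    subst j.
    have z : (x + \sum_(i in (l |: T)%SET) e i) l = 0%N :> nat.
      by rewrite translateN !inE eqxx /= xl addn1 modnn.
    have w : (x + \sum_(i in T) e i) l = N :> nat.
      by rewrite translateN (negbTE jT) /= xl addn0 modn_small.
    by rewrite (negbTE (s0 _ _ z)) (sN _ _ w) z w (negbTE N_even).
  have -> : (x + \sum_(i in (j |: T)%SET) e i) l = (x + \sum_(i in T) e i) l.
    by rewrite !translateE !inE eq_sym (negbTE jl).
  have [lT|lT] := boolP (l \in T).
    have z (T' : {set I}) : l \in T' -> (x + \sum_(i in T') e i) l = 0%N :> nat.
      by move=> lT'; rewrite translateN lT' /= xl addn1 modnn.
    rewrite (negbTE (s0 _ _ (z _ lT))) (negbTE (s0 _ _ (z _ _))) ?inE ?lT ?orbT //.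
    by rewrite /GRing.add /= addbb.
  have w (T' : {set I}) : l \notin T' -> (x + \sum_(i in T') e i) l = N :> nat.
    by move=> lT'; rewrite translateN (negbTE lT') /= xl addn0 modn_small.
  rewrite (sN _ _ (w _ lT)) (sN _ _ (w _ _)) ?inE ?negb_or ?lT 1?eq_sym ?jl //.
  by rewrite /GRing.add /= addbb.
have valE (T : {set I}) l : (x + \sum_(i in T) e i) l = (x l + (l \in T))%N :> nat.
  rewrite translateN /= modn_small //.
  by case: (l \in T); rewrite ?addn0 // addn1 ltnS.
exists x => l; have [T [j [jT]]] := path l; rewrite /a /h translateS //.
rewrite !valE !oddD !inE.
have bnd (T' : {set I}) i : (x i <= (x + \sum_(j in T') e j)%R i <= (x i).+1)%N.
  by rewrite valE leq_addr -[(x i).+1]addn1 leq_add2l leq_b1.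
set u := x + \sum_(i in (_ |: _)%SET) _; set v := x + \sum_(i in _) _ => H.
have {H} : s l u != s l v.
  move: H; have [->|_] := eqVneq l j; rewrite ?(negbTE jT) /=.
    by case: (s j u); case: (s j v); case: (odd (x j)).
  by case: (s l u); case: (s l v); case: (odd (x l)); case: (l \in T).
case su : (s l u); case sv : (s l v) => // _.
  by exists u, v; rewrite su sv; split=> // i; rewrite !bnd.
by exists v, u; rewrite su sv; split=> // i; rewrite !bnd.
Qed.
End grid.

(** * The maximum norm and the continuous Poincare-Miranda theorem *)

Section row_vector_norm.
Context {R : realType} {n : nat}.
Implicit Types x : 'rV[R]_n.

Lemma rV_norm_ltP x (r : R) : 0 < r ->
  reflect (forall i, `|x ord0 i| < r) (`|x| < r).
Proof.
move=> r0; have -> : `|x| = \big[Num.max/0]_ij `|x ij.1 ij.2| := mx_normrE x.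
apply: (iffP (bigmax_ltP _ _ _ _)).
  by move=> [_ H] i; exact: (H (ord0, i)).
by move=> H; split => // -[i j] _ /=; rewrite ord1.
Qed.

Lemma rV_norm_leP x (r : R) : 0 <= r ->
  reflect (forall i, `|x ord0 i| <= r) (`|x| <= r).
Proof.
move=> r0; have -> : `|x| = \big[Num.max/0]_ij `|x ij.1 ij.2| := mx_normrE x.
apply: (iffP (bigmax_leP _ _ _ _)).
  by move=> [_ H] i; exact: (H (ord0, i)).
by move=> H; split => // -[i j] _ /=; rewrite ord1.
Qed.

Lemma coord_le_norm x i : `|x ord0 i| <= `|x|.
Proof. by move: i; apply/rV_norm_leP. Qed.

Lemma compact_cube (a : R) : compact [set x : 'rV[R]_n | `|x| <= a].
Proof.
have [a0|a0] := leP 0 a; last first.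
  rewrite (_ : mkset _ = set0); first exact: compact0.
  by apply/seteqP; split => // x /= xa; have := le_lt_trans (le_trans (normr_ge0 x) xa) a0; rewrite ltxx.
rewrite (_ : mkset _ = [set x : 'rV[R]_n | forall i, `[(- a), a]%classic (x ord0 i)]).
  by apply: (rV_compact (A := fun=> `[(- a), a]%classic)) => i; exact: segment_compact.
apply/seteqP; split => x /=.
  by move/(rV_norm_leP _ a0) => H i; rewrite /= in_itv /= -ler_norml.
by move=> H; apply/rV_norm_leP => // i; rewrite ler_norml; have := H i; rewrite /= in_itv.
Qed.
End row_vector_norm.

(** Heine's covering argument with half radii; only [x] is confined to [K]. *)
Lemma compact_uniform_continuity (R : realType) (V W : normedModType R)
    (K : set V) (f : V -> W) (r : R) :
  compact K -> continuous f -> 0 < r ->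
  exists2 d, 0 < d & forall x y, K x -> `|x - y| < d -> `|f x - f y| < r.
Proof.
move=> /compact_near_coveringP cK cf r0.
have : \forall d \near (0:R)^'+, K `<=` (fun x => forall y, `|x - y| < d -> `|f x - f y| < r).
  apply: cK => x Kx.
  have r20 : 0 < r / 2 by rewrite divr_gt0.
  have /cvgrPdist_lt/(_ _ r20)/nbhs_normP[e /= e0 He] := cf x.
  exists (ball x (e / 2), [set d | d < e / 2]) => /=.
    split; first by apply: nbhsx_ballx; rewrite divr_gt0.
    by apply: nbhs_right_lt; rewrite divr_gt0.
  move=> [z d] /= []; rewrite -ball_normE /= => xz de y zy.
  rewrite -(subrKA (f x)) (splitr r) (le_lt_trans (ler_normD _ _)) // ltrD //.
    rewrite distrC; apply: He => /=; apply: lt_trans xz _.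
    by rewrite ltr_pdivrMr // ltr_pMr // ltr1n.
  apply: He => /=; rewrite -(subrKA z) (splitr e) (le_lt_trans (ler_normD _ _)) // ltrD //.
  exact: lt_trans de.
move=> H; near (0:R)^'+ => d; exists d => // x y Kx.
by move: y; exact: (near H d).
Unshelve. all: by end_near. Qed.

Lemma poincare_miranda (R : realType) (k : nat) (a r : R) (F : 'rV[R]_k -> 'rV[R]_k) :
  0 < a -> 0 < r -> continuous F ->
  (forall l (x : 'rV[R]_k), `|x| <= a -> x ord0 l = - a -> F x ord0 l <= 0) ->
  (forall l (x : 'rV[R]_k), `|x| <= a -> x ord0 l = a -> 0 < F x ord0 l) ->
  exists2 x : 'rV[R]_k, `|x| <= a & `|F x| < r.
Proof.
move=> a0 r0 cF Fneg Fpos.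
have [d d0 Fd] := compact_uniform_continuity (@compact_cube R k a) cF r0.
(* [N] is even, and large enough for the mesh [h] to be below the modulus of continuity [d]. *)
pose M := Num.bound (2 * a / d).
pose N := M.+1.*2.
have N0 : (0 < N)%N by [].
have Neven : ~~ odd N by rewrite odd_double.
have NR0 : 0 < N%:R :> R by rewrite ltr0n.
pose h : R := 2 * a / N%:R.
have h0 : 0 < h by rewrite divr_gt0 // mulr_gt0.
have hN : h * N%:R = 2 * a by rewrite divfK // gt_eqF.
have hd : h < d.
  rewrite ltr_pdivrMr // (mulrC d) -ltr_pdivrMr //.
  have /archi_boundP/lt_le_trans : 0 <= 2 * a / d by rewrite divr_ge0 ?ltW // mulr_gt0.
  by apply; rewrite ler_nat /N -addnn -/M; lia.
pose pt (x : {ffun 'I_k -> 'I_N.+1}) : 'rV[R]_k := \row_i (h * (x i)%:R - a).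
have pt_cube x : `|pt x| <= a.
  apply/rV_norm_leP => [|i]; first exact: ltW.
  have : (x i)%:R <= N%:R :> R by rewrite ler_nat -ltnS.
  have : 0 <= (x i)%:R :> R by rewrite ler0n.
  by rewrite mxE ler_norml; move: ((x i)%:R) hN h0 => t; nra.
have pt_close (x y : {ffun 'I_k -> 'I_N.+1}) : (forall i, (x i <= y i <= (x i).+1)%N) -> `|pt x - pt y| < d.
  move=> xy; apply: le_lt_trans hd; apply/rV_norm_leP => [|i]; first exact: ltW.
  rewrite !mxE opprB addrA subrK -mulrBr normrM (gtr0_norm h0) ler_piMr ?(ltW h0) //.
  have /andP[xy1 xy2] := xy i.
  by rewrite distrC -natrB // ger0_norm ?ler0n // (ler_nat _ _ 1) leq_subLR addn1.
pose s l x := 0 < F (pt x) ord0 l.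
have [|l x xN|x Hx] := discrete_poincare_miranda N0 Neven (s := s).
- move=> l x x0; rewrite /s -leNgt; apply: Fneg => //.
  by rewrite mxE x0 mulr0 sub0r.
- apply: Fpos => //; rewrite mxE xN hN; lra.
exists (pt x) => //; apply/rV_norm_ltP => // l.
(* The coordinate [l] of [F] is positive at [y] and nonpositive at [y'], and both values are within
   [r] of its value at [pt x]. *)
have [y [y' [sy sy' xyy']]] := Hx l.
have /(Fd _ _ (pt_cube x)) xy : `|pt x - pt y| < d by apply: pt_close => i; case: (xyy' i).
have /(Fd _ _ (pt_cube x)) xy' : `|pt x - pt y'| < d by apply: pt_close => i; case: (xyy' i).
have := le_lt_trans (coord_le_norm _ l) xy; have := le_lt_trans (coord_le_norm _ l) xy'.
move: sy sy'; rewrite /s -leNgt !mxE !ltr_norml => ? ? /andP[? ?] /andP[? ?].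
by apply/andP; split; lra.
Qed.

(** * Skeleta of a simplex and a pigeonhole argument *)

Section skeleton.
Variables (R : realType) (M : nat).
Implicit Types (z : 'rV[R]_M) (S : {set 'I_M}).

Definition support_set z : {set 'I_M} := [set v | z ord0 v != 0]%SET.

(* The (k - 1)-skeleton of the standard simplex. *)
Definition skeleton (k : nat) : set 'rV[R]_M :=
  [set z : 'rV[R]_M | [/\ forall v, 0 <= z ord0 v, \sum_v z ord0 v = 1
    & (#|support_set z| <= k)%N]].

Lemma skeleton_le1 k z v : skeleton k z -> z ord0 v <= 1.
Proof.
by move=> [z0 <- _]; rewrite (bigD1 v) //= lerDl sumr_ge0.
Qed.

(* All coordinates in the support but one are rounded down to a multiple of
   1/m; the last one is determined by the others. *)
Definition skeleton_cell (k m : nat) z : {set 'I_M} * {ffun 'I_k -> 'I_m.+1} :=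
  (support_set z, [ffun i : 'I_k =>
     if [pick v in support_set z] is Some v0 then
       inord (Num.truncn (m%:R * z ord0 (nth v0 (enum (support_set z :\ v0)%SET) i)))
     else ord0]).

Lemma skeleton_cell_close k m z z' : (0 < m)%N ->
  skeleton k.+1 z -> skeleton k.+1 z' ->
  skeleton_cell k m z = skeleton_cell k m z' -> `|z - z'| <= k.+1%:R / m%:R.
Proof.
move=> m0 Kz Kz' [SE /ffunP E].
have mR0 : 0 < m%:R :> R by rewrite ltr0n.
have [z0 z1 zk] := Kz; have [z'0 z'1 z'k] := Kz'.
have outS v : v \notin support_set z -> z ord0 v = 0 /\ z' ord0 v = 0.
  move=> vS; split; apply/eqP; first by move: vS; rewrite inE negbK.
  by move: vS; rewrite SE inE negbK.
move: E; rewrite -SE; case: pickP => [v0 v0S|S0] E; last first.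
  suff -> : z - z' = 0 by rewrite normr0 divr_ge0.
  apply/rowP => v; rewrite !mxE.
  by have [-> ->] := outS v (negbT (S0 v)); rewrite subr0.
have cE : #|support_set z| = #|support_set z :\ v0|%SET.+1.
  by rewrite (cardsD1 v0) v0S.
(* The support has at most [k.+1] elements, so the [k] slots of the cell record every coordinate
   other than [v0]. *)
have near_other v : v \in (support_set z :\ v0)%SET -> `|z ord0 v - z' ord0 v| <= m%:R^-1.
  move=> vS; have ik : (index v (enum (support_set z :\ v0)%SET) < k)%N.
    rewrite -ltnS (leq_trans _ zk) // cE ltnS cardE index_mem mem_enum //.
  have := E (Ordinal ik); rewrite !ffunE /= nth_index ?mem_enum // => /(congr1 val) /=.
  have ub y : skeleton k.+1 y -> (Num.truncn (m%:R * y ord0 v) < m.+1)%N.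
    move=> Ky; rewrite ltnS truncn_le_nat (le_lt_trans _ (_ : m%:R < _)) //.
      by rewrite ler_piMr // (skeleton_le1 _ Ky).
    by rewrite ltr_nat.
  rewrite !inordK ?ub // => tE.
  have /truncn_itv : 0 <= m%:R * z ord0 v by rewrite mulr_ge0.
  have /truncn_itv : 0 <= m%:R * z' ord0 v by rewrite mulr_ge0.
  rewrite -tE -[X in _ -> _ -> _ <= X]mul1r ler_pdivlMr //.
  have -> : `|z ord0 v - z' ord0 v| * m%:R = `|m%:R * z ord0 v - m%:R * z' ord0 v|.
    by rewrite -mulrBr normrM gtr0_norm // mulrC.
  rewrite ler_norml -natr1 => /andP[? ?] /andP[? ?].
  by apply/andP; split; lra.
(* The coordinate at [v0] is 1 minus the others, so its error is at most the sum of theirs. *)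
have sumE y : support_set y = support_set z -> \sum_v y ord0 v = 1 ->
    y ord0 v0 = 1 - \sum_(v in (support_set z :\ v0)%SET) y ord0 v.
  move=> Sy <-; rewrite (bigD1 v0) //= (bigID (mem (support_set z))) /=.
  rewrite [X in _ + (_ + X)]big1 ?addr0; last first.
    by move=> v /andP[_]; rewrite -Sy inE negbK => /eqP.
  rewrite (eq_bigl (mem (support_set z :\ v0)%SET)) ?addrK // => v.
  by rewrite !inE.
apply/rV_norm_leP => [|v]; first by rewrite divr_ge0.
rewrite !mxE; have [vS|vS] := boolP (v \in support_set z); last first.
  by have [-> ->] := outS _ vS; rewrite subr0 normr0 divr_ge0.
have [->|vv0] := eqVneq v v0; last first.
  apply: le_trans (near_other v _) _; first by rewrite finset.in_setD1 vv0.
  by rewrite -[leLHS]mul1r ler_pM2r ?invr_gt0 // ler1n.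
rewrite !sumE // opprB addrC addrA subrK -sumrB.
apply: le_trans (ler_norm_sum _ _ _) _.
apply: le_trans (ler_sum _ (G := fun=> m%:R^-1) _) _.
  by move=> w wS; rewrite distrC near_other.
rewrite sumr_const -[leLHS]mulr_natl ler_pM2r ?invr_gt0 // ler_nat.
by rewrite (leq_trans _ zk) // cE.
Qed.

(* A Lipschitz image of the k-dimensional skeleton in dimension k + 1 cannot
   come close to every point of a fine grid, by pigeonhole on the cells. *)
Lemma skeleton_image_misses_point k (Z : set 'rV[R]_M)
    (G : 'rV[R]_M -> 'rV[R]_k.+1) (b : R) :
  0 < b -> Z `<=` skeleton k.+1 -> (forall z z', `|G z - G z'| <= `|z - z'|) ->
  exists2 c : 'rV[R]_k.+1, `|c| <= b &
    exists2 rho : R, 0 < rho & forall z, Z z -> rho <= `|G z - c|.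
Proof.
move=> b0 ZK lipG; apply: contrapT => H.
(* [D] makes cells of diameter at most [rho]. [T] makes the [T ^ k.+1] grid points outnumber the
   cells, of which there are at most [2 ^ M * (D.+1 * T) ^ k]. *)
pose D := (Num.truncn (4 * k.+1%:R / b)).+1.
pose T := (2 ^ M * (D.+1) ^ k).+1.
pose m := (D * T)%N.
have T0 : 0 < T%:R :> R by rewrite ltr0n.
have Db : 4 * k.+1%:R <= D%:R * b.
  by rewrite -ler_pdivrMr // ltW // truncnS_gt.
have [rho rho0 rhoT] : exists2 rho, 0 < rho & 4 * rho * T%:R = b.
  exists (b / (4 * T%:R)); first by rewrite divr_gt0 // mulr_gt0.
  by field; rewrite gt_eqF.
have mrho : k.+1%:R / m%:R <= rho.
  rewrite ler_pdivrMr ?ltr0n ?muln_gt0 //.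
  have -> : rho * m%:R = D%:R * b / 4 by rewrite /m natrM -rhoT; field.
  by rewrite ler_pdivlMr // mulrC.
pose c (t : {ffun 'I_k.+1 -> 'I_T}) : 'rV[R]_k.+1 := \row_l (4 * rho * (t l)%:R).
have cb t : `|c t| <= b.
  apply/rV_norm_leP => [|l]; first exact: ltW.
  have rho40 : 0 <= 4 * rho by rewrite mulr_ge0 // ltW.
  rewrite mxE (ger0_norm (mulr_ge0 rho40 (ler0n _ _))) -[leRHS]rhoT ler_pM2l ?mulr_gt0 //.
  by rewrite ler_nat ltnW.
have /choice[z Hz] : forall t, exists z, Z z /\ `|G z - c t| < rho.
  move=> t; apply: contrapT => H'; apply: H; exists (c t) => //; exists rho => // z Zz.
  by rewrite leNgt; apply/negP => lt; apply: H'; exists z.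
(* If two grid points share a cell, they are within three times [rho] of each other, less than the
   grid spacing [4 * rho]. *)
have inj : injective (fun t => skeleton_cell k m (z t)).
  move=> t t' E; have [Zt Gt] := Hz t; have [Zt' Gt'] := Hz t'.
  have := skeleton_cell_close _ (ZK _ Zt) (ZK _ Zt') E.
  rewrite muln_gt0 => /(_ isT) zz.
  have ctt : `|c t - c t'| < 4 * rho.
    have -> : c t - c t' = (G (z t) - G (z t')) - (G (z t) - c t) + (G (z t') - c t').
      by apply/rowP => i; rewrite !mxE; ring.
    have := ler_normD ((G (z t) - G (z t')) - (G (z t) - c t)) (G (z t') - c t').
    have := ler_normB (G (z t) - G (z t')) (G (z t) - c t).
    have := le_trans (lipG (z t) (z t')) (le_trans zz mrho).
    move: Gt Gt'; set A := `|G (z t) - c t|; set B := `|G (z t') - c t'|.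
    by move=> *; lra.
  apply/ffunP => l; apply: val_inj; apply/eqP; move/rV_norm_ltP : ctt.
  move=> /(_ _ l); rewrite !mxE -mulrBr normrM (gtr0_norm (_ : 0 < 4 * rho)) ?mulr_gt0 //.
  rewrite gtr_pMr ?mulr_gt0 // => /(_ isT).
  rewrite !pmulrn -intrB -intr_norm (ltr_int _ _ 1) => tt1.
  by rewrite -eqz_nat -subr_eq0 -normr_le0 -ltzD1 add0r.
have := leq_card _ inj.
rewrite card_prod !card_ffun !card_ord -cardsT -powersetT card_powerset cardsT card_ord.
have mT : (m.+1 <= D.+1 * T)%N by rewrite /m mulSn addnC -addn1 leq_add2l.
have : (m.+1 ^ k <= (D.+1 * T) ^ k)%N.
  by case: (k) => // j; rewrite leq_exp2r.
move=> /(leq_mul (leqnn (2 ^ M))) H1 H2; have := leq_trans H2 H1.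
rewrite expnMn expnS mulnA leq_pmul2r ?expn_gt0 //.
by rewrite ltnn.
Qed.
End skeleton.

(** * Lipschitz maps and the distance to a set *)

Lemma lipschitz1_continuous (R : realType) (T : topologicalType)
    (V W : normedModType R) (f : T -> V) (h : V -> W) :
  continuous f -> (forall z z', `|h z - h z'| <= `|z - z'|) -> continuous (h \o f).
Proof.
move=> cf hL x; apply/cvgrPdist_lt => e e0; near=> y.
rewrite /= (le_lt_trans (hL _ _)) //; near: y.
by move/cvgrPdist_lt : (cf x); exact.
Unshelve. all: by end_near. Qed.

Section distance_to_set.
Variables (R : realType) (V : normedModType R) (A : set V).

Definition set_dist (x : V) : R := inf [set `|x - a| | a in A].

Let lb_set_dist x : has_lbound [set `|x - a| | a in A].
Proof. by exists 0 => _ [a _ <-]. Qed.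

Lemma set_dist_le x a : A a -> set_dist x <= `|x - a|.
Proof. by move=> Aa; apply: ge_inf => //; exists a. Qed.

Hypothesis A_neq0 : A !=set0.

Lemma le_set_dist x (e : R) : (forall a, A a -> e <= `|x - a|) -> e <= set_dist x.
Proof.
move=> H; apply: lb_le_inf; last by move=> _ [a Aa <-]; exact: H.
by have [a Aa] := A_neq0; exists `|x - a|, a.
Qed.

Lemma set_dist_lipschitz x y : `|set_dist x - set_dist y| <= `|x - y|.
Proof.
have half u v : set_dist u - set_dist v <= `|u - v|.
  rewrite lerBlDr addrC -lerBlDr; apply: le_set_dist => a Aa.
  rewrite lerBlDr addrC; apply: le_trans (set_dist_le _ Aa) _.
  by rewrite -(subrKA v) ler_normD.
by rewrite ler_norml half andbT lerNl opprB distrC half.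
Qed.
End distance_to_set.

Lemma finite_pos_lower_bound (R : realType) (I : finType) (e : I -> R) :
  (forall i, 0 < e i) -> exists2 d, 0 < d & forall i, d <= e i.
Proof.
move=> e0; exists (\big[Num.min/1]_i e i).
  by apply/bigmin_gtP; split=> // i _.
by move=> i; exact: bigmin_le_cond.
Qed.

(** * Opposite faces of a cube mapped to a skeleton *)

Section opposite_faces.
Variables (R : realType) (k : nat) (a : R).

Definition face (l : 'I_k) (c : R) : set 'rV[R]_k :=
  [set x : 'rV[R]_k | `|x| <= a /\ x ord0 l = c].

Lemma compact_face l c : compact (face l c).
Proof.
apply: (@subclosed_compact _ _ [set x : 'rV[R]_k | `|x| <= a]).
- rewrite (_ : face l c = [set x : 'rV[R]_k | `|x| <= a] `&`
    (fun x : 'rV[R]_k => x ord0 l) @^-1` [set c]); last first.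
    by apply/seteqP; split => x.
  apply: closedI.
    apply: compact_closed; first exact: norm_hausdorff.
    exact: compact_cube.
  apply: closed_comp => [x _|]; first exact: coord_continuous.
  exact: closed_eq.
- exact: compact_cube.
- by move=> x [].
Qed.

Lemma face_neq0 l c : `|c| <= a -> face l c !=set0.
Proof.
move=> ca; exists (const_mx c); split; last by rewrite mxE.
by apply/rV_norm_leP => [|i]; [exact: le_trans ca|rewrite mxE].
Qed.
End opposite_faces.

Lemma opposite_faces_meet (R : realType) (k M : nat) (a : R)
    (f : 'rV[R]_k.+1 -> 'rV[R]_M) :
  0 < a -> continuous f -> (forall x, `|x| <= a -> skeleton k.+1 (f x)) ->
  exists l x y, [/\ face a l (- a) x, face a l a y & f x = f y].
Proof.
move=> a0 cf Kf; apply: contrapT => nmeet.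
have na : `|- a| <= a by rewrite normrN gtr0_norm.
have pa : `|a| <= a by rewrite gtr0_norm.
(* Disjoint images of compact faces are a positive distance apart. *)
have sep l : exists2 e : R, 0 < e &
    forall x y, face a l (- a) x -> face a l a y -> e <= `|f x - f y|.
  pose A := face a l (- a) `*` face a l a.
  pose g (u : 'rV[R]_k.+1 * 'rV[R]_k.+1) := `|f u.1 - f u.2|.
  have cA : compact A by apply: compact_setX; exact: compact_face.
  have A0 : A !=set0.
    have [x ?] := face_neq0 l na; have [y ?] := face_neq0 l pa.
    by exists (x, y).
  have cg : {within A, continuous g}.
    apply: continuous_subspaceT => u; apply: cvg_norm; apply: cvgB.
      by apply: continuous_comp; [exact: cvg_fst|exact: cf].
    by apply: continuous_comp; [exact: cvg_snd|exact: cf].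
  have [[x y] /set_mem[/= Ax Ay] gmin] := compact_EVT_min A0 cA cg.
  exists (g (x, y)).
    rewrite /g /= normr_gt0 subr_eq0; apply/eqP => fxy.
    by apply: nmeet; exists l, x, y.
  by move=> x' y' Ax' Ay'; apply: (gmin (x', y')); apply: mem_set.
have {sep} [eta eta0 sep] : exists2 e : R, 0 < e &
    forall l x y, face a l (- a) x -> face a l a y -> e <= `|f x - f y|.
  have /choice[e He] : forall l, exists e : R, 0 < e /\
      forall x y, face a l (- a) x -> face a l a y -> e <= `|f x - f y|.
    by move=> l; have [e] := sep l; exists e.
  have [d d0 de] := finite_pos_lower_bound (fun l => (He l).1).
  exists d => // l x y Ax Ay; apply: le_trans (de l) _.
  exact: (He l).2.
pose D l := set_dist (f @` face a l (- a)).
have D0 l : f @` face a l (- a) !=set0.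
  by have [x ?] := face_neq0 l na; exists (f x), x.
(* After the shift by [eta / 2], the coordinate [l] is at most [- eta / 2] on the negative face and
   at least [eta / 2] on the positive one; subtracting a [c] of norm at most [eta / 4] keeps both
   signs. *)
pose G (z : 'rV[R]_M) : 'rV[R]_k.+1 := \row_l (D l z - eta / 2).
have lipG z z' : `|G z - G z'| <= `|z - z'|.
  apply/rV_norm_leP => // l; rewrite !mxE opprB addrA subrK.
  exact: set_dist_lipschitz.
have eta40 : 0 < eta / 4 by rewrite divr_gt0.
have [c ceta [rho rho0 Gc]] : exists2 c : 'rV[R]_k.+1, `|c| <= eta / 4 &
    exists2 rho : R, 0 < rho &
      forall z, (f @` [set x | `|x| <= a]) z -> rho <= `|G z - c|.
  by apply: skeleton_image_misses_point => // _ [x xa <-]; exact: Kf.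
have cl l : `|c ord0 l| <= eta / 4 by apply: le_trans (coord_le_norm _ _) ceta.
have cF : continuous (fun x => G (f x) - c).
  apply: (lipschitz1_continuous (h := fun z => G z - c)) => // z z'.
  by rewrite opprB addrA subrK; exact: lipG.
have [|l x xa xl|x xa] := poincare_miranda a0 rho0 cF.
- move=> l x xa xl; have : D l (f x) <= 0.
    have := @set_dist_le _ _ (f @` face a l (- a)) (f x) (f x).
    by rewrite subrr normr0; apply; exists x.
  by have := cl l; rewrite ler_norml !mxE => /andP[? ?] ?; lra.
- have : eta <= D l (f x).
    by apply: le_set_dist => // _ [y Ay <-]; rewrite distrC; exact: (sep l y x Ay (conj xa xl)).
  by have := cl l; rewrite ler_norml !mxE => /andP[? ?] ?; lra.
- by apply/negP; rewrite -leNgt; apply: Gc; exists x.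
Qed.

(** * Polyhedra with the coherent topology *)

Lemma rV_continuous (R : realType) (M : nat) (T : topologicalType)
    (f : T -> 'rV[R]_M) :
  (forall i, continuous (fun x => f x ord0 i)) -> continuous f.
Proof.
move=> cf x; apply/cvgrPdist_lt => e e0.
have : \forall y \near x, forall i, `|f x ord0 i - f y ord0 i| < e.
  by apply: filter_forall => i; move/cvgrPdist_lt : (cf i x); exact.
apply: filterS => y H; apply/rV_norm_ltP => // i; rewrite !mxE; exact: H.
Qed.

Section polyhedron_theory.
Variables (R : realType) (V : choiceType) (K : simplicial_complex V).
Local Notation P := (polyhedron R K).
Implicit Types (a b : P) (s t : {fset V}).

Lemma polyhedron_ext a b : (forall v, a v = b v) -> a = b.
Proof.
case: a b => [a Pa] [b Pb] /= /funext ab; subst b.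
by congr Polyhedron; exact: Prop_irrelevance.
Qed.

Lemma closed_simplex_sum s t (a : V -> R) : closed_simplex t a ->
  (forall v, v \notin s -> a v = 0) -> \sum_(v <- s) a v = 1.
Proof.
move=> [_ at0 <-] as0.
transitivity (\sum_(v <- (s `|` t)%fset) a v).
  by apply: big_fset_incl; [exact: fsubsetUl|move=> v _ /as0].
by apply/esym/big_fset_incl; [exact: fsubsetUr|move=> v _ /at0].
Qed.

Lemma polyhedron_ge0 a v : 0 <= a v.
Proof. by case: (baryP a) => s _ []. Qed.

(** The support is a face of any simplex carrying the point, nonempty because the coordinates sum to
    1; hence it is itself a simplex of [K]. *)
Lemma polyhedron_support :
  exists supp : P -> {fset V}, forall a, K (supp a) /\
    forall v, (v \in supp a) = (a v != 0).
Proof.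
suff /choice[supp Hs] : forall a, exists s, K s /\
  forall v, (v \in s) = (a v != 0) by exists supp.
move=> a; have [t Kt at_] := baryP a; have [_ at0 _] := at_.
pose s := [fset v in t | a v != 0]%fset.
have sE v : (v \in s) = (a v != 0).
  rewrite !inE /=; have [//|vt] := boolP (v \in t).
  by rewrite at0 // eqxx.
exists s; split => //; apply: simplex_sub Kt _ _; first exact: fset_sub.
apply/eqP => s0; have : \sum_(v <- s) a v = 1.
  apply: closed_simplex_sum at_ _ => v; rewrite sE negbK => /eqP //.
by rewrite s0 big_seq_fset0 => /esym/eqP; rewrite oner_eq0.
Qed.

Lemma polyhedron_openE : (open : set_system P) = @polyhedron_open R V K.
Proof. by []. Qed.

Lemma bary_continuous v : continuous (fun a : P => (a : V -> R) v).
Proof.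
apply/continuousP => U oU; rewrite polyhedron_openE => s a Ks Ua sa.
have /nbhs_ballP[e e0 eU] : nbhs ((a : V -> R) v) U by exact: open_nbhs_nbhs.
by exists e => // b sb /(_ v) ab; apply: eU.
Qed.

(* Choose one point of the image in each open simplex that the image meets:
   in the coherent topology, these points form a closed discrete set. *)
Lemma compact_finite_supports (T : ptopologicalType) (C : set T) (g : T -> P) :
  compact C -> continuous g ->
  exists s, forall x, C x -> forall v, v \notin s -> g x v = 0.
Proof.
move=> cC cg; have [supp Hsupp] := polyhedron_support.
have suppE a v : (v \in supp a) = (a v != 0) by case: (Hsupp a).
have [->|/set0P[x0 Cx0]] := eqVneq C set0; first by exists fset0 => x [].
have /choice[rep Hrep] : forall s, exists y : P,
    (exists2 x, C x & supp (g x) = s) -> exists2 x, C x & supp y = s /\ y = g x.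
  move=> s; have [[x Cx xs]|H] := pselect (exists2 x, C x & supp (g x) = s).
    by exists (g x) => _; exists x.
  by exists (g x0).
(* [W x] excludes all the chosen representatives except possibly [g x]. *)
pose W x : set P := [set y | rep (supp y) = y -> y = g x].
have oW x : open (W x).
  rewrite polyhedron_openE => s a Ks Wa sa.
  (* A closed simplex [s] has finitely many faces, so only finitely many representatives have to be
     kept at a distance from [a]. *)
  have e_ex (t : fset_sub_type (fpowerset s)) : exists e : R, 0 < e /\
      (rep (fsval t) <> a -> exists v, e <= `|a v - rep (fsval t) v|).
    have [->|ne] := pselect (rep (fsval t) = a); first by exists 1.
    have [v vne] : exists v, a v != rep (fsval t) v.
      apply: contrapT => H; apply: ne; apply: polyhedron_ext => v.
      by apply/esym/eqP; rewrite -[_ == _]negbK; apply/negP => H'; apply: H; exists v.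
    exists `|a v - rep (fsval t) v|; split; last by move=> _; exists v.
    by rewrite normr_gt0 subr_eq0.
  have [e He] := choice e_ex.
  have [d d0 de] := finite_pos_lower_bound (fun u => (He u).1).
  exists d => // b sb ab bb; have [ba|ba] := pselect (b = a).
    by move: bb; rewrite ba => /Wa.
  have ts : supp b \in fpowerset s.
    rewrite fpowersetE; apply/fsubsetP => v; rewrite suppE.
    by apply: contraR => vs; case: sb => _ /(_ _ vs) ->.
  have [|v] := (He [` ts]%fset).2; first by rewrite /= bb.
  rewrite /= bb => ev; have := ab v; rewrite ltNge => /negP[].
  exact: le_trans (de _) ev.
have gW y : C y -> W y (g y) by [].
have : (@cover_compact T) C by rewrite -(@compact_cover T).
case/(_ T C (fun x => g @^-1` (W x))) => [x _|x Cx|D DC CD].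
- by move/continuousP : cg; apply; exact: oW.
- by exists x.
exists (\bigcup_(x <- D) supp (g x))%fset => x Cx v vD.
(* The representative with the support of [g x] is some [g x']. The member of the finite subcover
   that contains [x'] forces it to be one of finitely many points [g i]. *)
have [x' Cx' [sx' yx']] : exists2 x', C x' &
    supp (rep (supp (g x))) = supp (g x) /\ rep (supp (g x)) = g x'.
  by apply: Hrep; exists x.
have [i /= iD] := CD _ Cx'; rewrite /W /= -yx' sx' => /(_ erefl) yi.
apply/eqP; rewrite -[_ == _]negbK -suppE -sx' yi; apply: contra vD => vi.
by apply/bigfcupP; exists i => //; rewrite iD.
Qed.
End polyhedron_theory.

(** By compactness, finitely many vertices [s] carry the image of the cube. The coordinates at these
    vertices determine its points and map it to a skeleton in a finite-dimensional space. *)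
Lemma polyhedron_opposite_faces_meet (R : realType) (V : choiceType)
    (K : simplicial_complex V) (k : nat) (a : R) (g : 'rV[R]_k.+1 -> polyhedron R K) :
  0 < a -> (forall s, K s -> (#|` s| <= k.+1)%N) -> continuous g ->
  exists l x y, [/\ face a l (- a) x, face a l a y & g x = g y].
Proof.
move=> a0 dimK cg.
have [s Hs] := compact_finite_supports (@compact_cube R k.+1 a) cg.
pose vtx := tnth (in_tuple s).
pose f x : 'rV[R]_(size s) := \row_i g x (vtx i).
have cf : continuous f.
  apply: rV_continuous => i; rewrite (_ : (fun x => _) = (fun x => g x (vtx i))).
    by move=> x; exact: (continuous_comp (cg x) (@bary_continuous _ _ _ (vtx i) _)).
  by apply/funext => x; rewrite mxE.
have Kf x : `|x| <= a -> skeleton k.+1 (f x).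
  move=> xa; have [t Kt gt] := baryP (g x); have [g0 gt0 _] := gt; split.
  - by move=> i; rewrite mxE.
  - under eq_bigr do rewrite mxE.
    by rewrite -(big_tnth _ _ s predT (g x)); apply: (closed_simplex_sum gt (Hs _ xa)).
  - apply: (leq_trans _ (dimK _ Kt)); rewrite cardE -(size_map vtx).
    apply: uniq_leq_size.
      rewrite map_inj_uniq ?enum_uniq // => i j /eqP.
      rewrite /vtx !(tnth_nth (vtx i)) nth_uniq //= => /eqP ij.
      exact: val_inj.
    move=> v /mapP[i]; rewrite mem_enum inE mxE => gi ->.
    by apply: contraNT gi => /gt0 ->.
have [l [x [y [Fx Fy fxy]]]] := opposite_faces_meet a0 cf Kf.
exists l, x, y; split => //; apply: polyhedron_ext => v.
have [vs|vs] := boolP (v \in s); last by rewrite !Hs //; [case: Fy|case: Fx].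
have vsize : (index v s < size s)%N by rewrite index_mem.
move/rowP/(_ (Ordinal vsize)) : fxy; rewrite !mxE /vtx (tnth_nth v) /=.
by rewrite nth_index.
Qed.

(** * The unit ball of the l^p norm *)

Section lp_norm_ball.
Variables (R : realType) (n : nat) (p : R).
Hypothesis p_ge1 : 1 <= p.
Implicit Types x : 'rV[R]_n.

Let p_gt0 : 0 < p. Proof. exact: lt_le_trans p_ge1. Qed.

Let one_powR q : (1 : R) `^ q = 1. Proof. by rewrite powR1. Qed.

Lemma lp_ballE x : lp_ball p x <-> \sum_i `|x ord0 i| `^ p <= 1.
Proof.
have S0 : 0 <= \sum_i `|x ord0 i| `^ p by apply: sumr_ge0 => i _; exact: powR_ge0.
have pV : 0 < p^-1 by rewrite invr_gt0.
split=> [|H].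
  rewrite /lp_ball /= => H; rewrite leNgt; apply/negP => S1.
  move: H; rewrite leNgt => /negP; apply; rewrite -[ltLHS](one_powR p^-1).
  by apply: gt0_ltr_powR => //; rewrite nnegrE.
rewrite /lp_ball /= -[leRHS](one_powR p^-1).
by apply: ge0_ler_powR => //; rewrite ?nnegrE // ltW.
Qed.

Lemma powR_natVK (k : nat) : (0 < k)%N -> (k%:R `^ (- p^-1)) `^ p = k%:R^-1 :> R.
Proof.
move=> k0; rewrite -powRrM mulNr mulVf ?gt_eqF //.
by rewrite powRN powRr1.
Qed.

Lemma lp_ball_coord_le1 x i : lp_ball p x -> `|x ord0 i| <= 1.
Proof.
move/lp_ballE => H; rewrite leNgt; apply/negP => xi.
have : 1 < `|x ord0 i| `^ p.
  rewrite -[ltLHS](one_powR p); apply: gt0_ltr_powR => //; rewrite nnegrE //.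
rewrite ltNge => /negP; apply; apply: le_trans H.
by rewrite (bigD1 i) //= lerDl sumr_ge0 // => j _; exact: powR_ge0.
Qed.

(** Otherwise at least [m.+1] coordinates would have a p-th power above [m.+1%:R^-1], and these
    powers would sum to more than 1. *)
Lemma card_large_coords x (r : R) (m : nat) :
  lp_ball p x -> m.+1%:R `^ (- p^-1) <= r ->
  (#|[set i : 'I_n | (r < `|x ord0 i|)%R]%SET| <= m)%N.
Proof.
move=> /lp_ballE H mr; rewrite leqNgt; apply/negP => mS.
set S := [set i | _]%SET in mS.
have q0 : 0 < m.+1%:R `^ (- p^-1) :> R by exact: powR_gt0.
have : \sum_(i in S) (m.+1%:R^-1) < \sum_(i in S) `|x ord0 i| `^ p.
  apply: ltr_sum.
    have /card_gt0P[i iS] : (0 < #|S|)%N by exact: leq_ltn_trans mS.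
    by apply/hasP; exists i => //; rewrite mem_index_enum.
  move=> i; rewrite inE => ri; rewrite -(powR_natVK (ltn0Sn m)).
  apply: gt0_ltr_powR => //; rewrite ?nnegrE ?powR_ge0 //.
  exact: le_lt_trans ri.
apply/negP; rewrite -leNgt.
apply: (@le_trans _ _ 1).
  apply: le_trans H; rewrite [leRHS](bigID (mem S)) /= lerDl sumr_ge0 //.
by rewrite sumr_const -[leRHS]mulr_natl ler_pdivlMr ?ltr0n // mul1r ler_nat.
Qed.
End lp_norm_ball.

(** * The lower bound: a cube inside the ball *)

Section lower_bound.
Variables (R : realType) (n k : nat) (p : R).
Hypotheses (p_ge1 : 1 <= p) (kn : (k < n)%N).

Let a : R := k.+1%:R `^ (- p^-1).

Let a_gt0 : 0 < a. Proof. exact: powR_gt0. Qed.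

(** Clamping extends the inclusion of the cube [[-a, a]^(k+1)] to a continuous map on the whole
    space, the form in which [polyhedron_opposite_faces_meet] takes its map. *)
Let clamp (t : R) : R := Num.max (- a) (Num.min a t).

Let clamp_le t : `|clamp t| <= a.
Proof.
have ha := a_gt0; rewrite /clamp ler_norml; case: (ltP a t) => ?; case: (ltP (- a)) => *; apply/andP; split; lra.
Qed.

Let clamp_id t : `|t| <= a -> clamp t = t.
Proof.
rewrite /clamp ler_norml => /andP[? ?]; have ha := a_gt0.
by case: (ltP a t) => ?; case: (ltP (- a)) => *; lra.
Qed.

Let clamp_lipschitz s t : `|clamp s - clamp t| <= `|s - t|.
Proof.
have ha := a_gt0; have h1 := ler_norm (s - t).
have := ler_norm (- (s - t)); rewrite normrN => h2.
rewrite /clamp ler_norml.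
by case: (ltP a s) => ?; case: (ltP a t) => ?; case: (ltP (- a) _) => ?; do ?[case: (ltP (- a) _) => ?];
  apply/andP; split; lra.
Qed.

Let cube_map (x : 'rV[R]_k.+1) : 'rV[R]_n :=
  \row_(i < n) if (i <= k)%N then clamp (x ord0 (inord i)) else 0.

Let cube_map_ball x : lp_ball p (cube_map x).
Proof.
apply/lp_ballE => //.
rewrite (bigID (fun i : 'I_n => (i < k.+1)%N)) /= [X in _ + X]big1 ?addr0; last first.
  by move=> i; rewrite ltnS mxE => /negbTE ->; rewrite normr0 powR0 // gt_eqF // (lt_le_trans _ p_ge1).
apply: (@le_trans _ _ (\sum_(i < n | (i < k.+1)%N) k.+1%:R^-1)).
  apply: ler_sum => i ik; rewrite mxE -ltnS ik -(powR_natVK p_ge1) //.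
  by apply: ge0_ler_powR; rewrite ?nnegrE ?(le_trans _ p_ge1) ?(ltW a_gt0) //; exact: clamp_le.
by rewrite -(big_ord_widen n (fun=> k.+1%:R^-1)) // sumr_const card_ord -[leLHS]mulr_natl divff // pnatr_eq0.
Qed.

Let cube_ball (x : 'rV[R]_k.+1) : lp_ball_linfty n p :=
  SigSub (mem_set (cube_map_ball x)).

Let cube_ball_continuous : continuous cube_ball.
Proof.
apply: continuous_comp_initial; apply: (@lipschitz1_continuous R _ 'rV[R]_k.+1 'rV[R]_n id cube_map).
  by move=> x; exact: cvg_id.
move=> x y; apply/rV_norm_leP => // i; rewrite !mxE.
case: ifP => _; last by rewrite subrr normr0.
apply: le_trans (clamp_lipschitz _ _) _.
by have := coord_le_norm (x - y) (inord i); rewrite !mxE.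
Qed.

Lemma lp_ball_embedding_dim_gt (eps : R) j : eps < 2 * a ->
  eps_embeds_in_dim (lp_ball_linfty n p) eps j -> (k < j)%N.
Proof.
move=> epsa [V [K [f [[_ Kdim] [cf fdiam]]]]]; rewrite ltnNge; apply/negP => jk.
have [l [x [y [[xa xl] [ya yl] gxy]]]] : exists l x y,
    [/\ face a l (- a) x, face a l a y & f (cube_ball x) = f (cube_ball y)].
  apply: polyhedron_opposite_faces_meet => //.
    by move=> s /Kdim sj; rewrite (leq_trans sj) // ltnS.
  by move=> x; apply: continuous_comp; [exact: cube_ball_continuous|exact: cf].
(* [cube_ball x] and [cube_ball y] lie in one fibre, and their coordinates at [l] are [- a] and
   [a]. *)
have : ((2 * a)%:E <= eps%:E)%E.
  apply: le_trans (fdiam (f (cube_ball y))).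
  apply: (@le_trans _ _ (mdist (cube_ball y) (cube_ball x))%:E); last first.
    by apply: ereal_sup_ubound; right; exists (cube_ball y) => //; exists (cube_ball x).
  rewrite lee_fin -[leRHS]/(`|cube_map y - cube_map x|).
  have ln : (l < n)%N by rewrite (leq_trans (ltn_ord l)).
  apply: le_trans (coord_le_norm _ (Ordinal ln)).
  rewrite !mxE /= -ltnS ltn_ord inord_val !clamp_id ?xl ?yl ?normrN ?(gtr0_norm a_gt0) //.
  by rewrite opprK (le_trans _ (ler_norm _)) // mulr_natl mulr2n.
by rewrite lee_fin leNgt epsa.
Qed.
End lower_bound.

(** * The upper bound: maps into polyhedra and soft thresholding *)

(** When finitely many vertices carry the whole image, only finitely many simplices matter, and
    coordinatewise continuity gives one radius that serves them all. *)
Lemma continuous_to_polyhedron (R : realType) (V : choiceType)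
    (K : simplicial_complex V) (T : topologicalType) (f : T -> polyhedron R K)
    (s0 : {fset V}) :
  (forall x v, v \notin s0 -> f x v = 0) ->
  (forall v, continuous (fun x => f x v)) -> continuous f.
Proof.
move=> fs0 cf x A; rewrite nbhsE => -[U [oU Ux] UA].
move: oU; rewrite polyhedron_openE => oU.
have [supp Hsupp] := polyhedron_support R K.
have suppE a v : (v \in supp a) = (a v != 0) by case: (Hsupp a).
have e_ex (u : fset_sub_type (fpowerset s0)) : exists e : R, 0 < e /\
    (K (fsval u) -> closed_simplex (fsval u) (f x) ->
     forall b : polyhedron R K, closed_simplex (fsval u) b ->
       (forall v, `|f x v - b v| < e) -> U b).
  have [Ku|nKu] := pselect (K (fsval u)); last by exists 1.
  have [xu|nxu] := pselect (closed_simplex (fsval u) (f x)); last by exists 1.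
  by have [e e0 eU] := oU _ _ Ku Ux xu; exists e.
have [e He] := choice e_ex.
have [d d0 de] := finite_pos_lower_bound (fun u => (He u).1).
(* Coordinates that are nonzero at [x] stay nonzero nearby, so the closed simplex on the support of
   [f y] also contains [f x]; openness of [U] is tested there. *)
have : \forall y \near x, forall v : fset_sub_type s0,
    `|f x (fsval v) - f y (fsval v)| < d /\
    (f x (fsval v) != 0 -> f y (fsval v) != 0).
  apply: filter_forall => v.
  have cfv (e1 : R) : 0 < e1 -> \forall y \near x, `|f x (fsval v) - f y (fsval v)| < e1.
    by move=> e10; move/cvgrPdist_lt : (cf (fsval v) x); exact.
  have [fx0|fx0] := eqVneq (f x (fsval v)) 0.
    by apply: filterS (cfv _ d0) => y; rewrite fx0.
  have fx_gt0 : 0 < `|f x (fsval v)| by rewrite normr_gt0.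
  apply: filterS2 (cfv _ d0) (cfv _ fx_gt0) => y yd yf; split => // _.
  by apply/eqP => fy0; move: yf; rewrite fy0 subr0 ltxx.
apply: filterS => y Hy; apply: UA.
have fxy v : f x v != 0 -> f y v != 0.
  move=> fx; have vs : v \in s0 by apply: contraR fx => /fs0 ->.
  exact: (Hy [` vs]%fset).2.
have us : supp (f y) \in fpowerset s0.
  by rewrite fpowersetE; apply/fsubsetP => v; rewrite suppE; apply: contraR => /fs0 ->.
have sfy v : v \notin supp (f y) -> f y v = 0 by rewrite suppE negbK => /eqP.
have sfx v : v \notin supp (f y) -> f x v = 0.
  by rewrite suppE => H; apply/eqP; apply: contraR H => /fxy.
have sum1 (b : polyhedron R K) : (forall v, v \notin supp (f y) -> b v = 0) ->
    closed_simplex (supp (f y)) b.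
  move=> H; split => // [v|]; first exact: polyhedron_ge0.
  by have [t _ tb] := baryP b; exact: closed_simplex_sum tb H.
apply: ((He [` us]%fset).2 (Hsupp _).1 (sum1 _ sfx) _ (sum1 _ sfy)) => v.
apply: lt_le_trans (de _).
have [vs|vs] := boolP (v \in s0); first by case: (Hy [` vs]%fset).
by rewrite !fs0 // subrr normr0.
Qed.

Section skeleton_complex.
Variables (T : finType) (m : nat).

Let small (s : {fset T}) : Prop := s != fset0 /\ (#|` s| <= m.+1)%N.

Let small_neq0 s : small s -> s != fset0. Proof. by case. Qed.

Let small_sub (s t : {fset T}) : small s -> (t `<=` s)%fset -> t != fset0 -> small t.
Proof.
by move=> [_ sm] ts t0; split => //; rewrite (leq_trans _ sm) // fsubset_leq_card.
Qed.

Definition skeleton_complex : simplicial_complex T :=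
  SimplicialComplex small_neq0 small_sub.

Lemma skeleton_complex_dim : (m < #|T|)%N -> complex_has_dim skeleton_complex m.
Proof.
move=> mT; split; last by move=> s [].
have c : #|` [fset v in take m.+1 (enum T)]%fset| = m.+1.
  rewrite card_fseq undup_id ?take_uniq ?enum_uniq // size_takel // -cardE //.
by exists [fset v in take m.+1 (enum T)]%fset; rewrite ?c //; split;
  rewrite ?c // -cardfs_gt0 c.
Qed.
End skeleton_complex.

Section soft_threshold.
Variables (R : realType) (n : nat) (r : R).
Hypotheses (n_gt0 : (0 < n)%N) (r_gt0 : 0 < r).
Implicit Types x y : 'rV[R]_n.

(** The positive and negative parts of the soft thresholding of [t] are kept apart, since
    barycentric coordinates are nonnegative. *)
Definition excess (b : bool) (t : R) : R := Num.max 0 ((if b then t else - t) - r).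

Lemma excess_ge0 b t : 0 <= excess b t. Proof. by rewrite le_max lexx. Qed.

(** The two parts add up to [max(0, |t| - r)], whence the constant 1 for the sum as well. *)
Lemma excess_lipschitz t u :
  `|(excess true t + excess false t) - (excess true u + excess false u)| <= `|t - u| /\
  forall b, `|excess b t - excess b u| <= `|t - u|.
Proof.
have h1 := ler_norm (t - u); have := ler_norm (- (t - u)); rewrite normrN => h2.
have hr := r_gt0; rewrite /excess; split=> [|[]] /=; rewrite ler_norml;
  case: (ltP 0 (t - r)) => ?; case: (ltP 0 (u - r)) => ?;
  case: (ltP 0 (- t - r)) => ?; case: (ltP 0 (- u - r)) => ?;
  apply/andP; split; lra.
Qed.

Lemma excess_sum t : `|t| <= 1 -> excess true t + excess false t <= 1.
Proof.
have hr := r_gt0; rewrite ler_norml /excess /= => /andP[? ?].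
by case: (ltP 0 (t - r)) => ?; case: (ltP 0 (- t - r)) => ?; lra.
Qed.

(** A fibre of soft thresholding is a single point or the interval [[-r, r]]. *)
Lemma excess_inj t u : (forall b, excess b t = excess b u) -> `|t - u| <= 2 * r.
Proof.
move=> H; have hr := r_gt0; move: (H true) (H false); rewrite /excess ler_norml /=.
by case: (ltP 0 (t - r)) => ?; case: (ltP 0 (u - r)) => ?;
  case: (ltP 0 (- t - r)) => ?; case: (ltP 0 (- u - r)) => ? *;
  apply/andP; split; lra.
Qed.

Lemma excess_neq0 b t : excess b t != 0 -> r < `|t| /\ b = (0 < t).
Proof.
have hr := r_gt0; rewrite /excess; case: b => /=; case: (ltP 0 (_ - r)) => [h _|_ /eqP//]; split.
- by rewrite (lt_le_trans _ (ler_norm _)) // -subr_gt0.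
- by apply/esym; lra.
- by rewrite -normrN (lt_le_trans _ (ler_norm _)) // -subr_gt0.
- by apply/esym/negbTE; rewrite -leNgt; lra.
Qed.

(** There is one vertex for each coordinate and sign. Division by [n] keeps their total weight at
    most 1 on the unit cube, and [None] receives the rest. *)
Definition spread x (v : option ('I_n * bool)) : R :=
  if v is Some (i, b) then excess b (x ord0 i) / n%:R
  else 1 - (\sum_i (excess true (x ord0 i) + excess false (x ord0 i))) / n%:R.

Let nR_gt0 : 0 < n%:R :> R. Proof. by rewrite ltr0n. Qed.

Lemma sum_spread x : \sum_v spread x v = 1.
Proof.
rewrite (bigD1 None) //= (reindex_omap Some id) /=; last by case.
rewrite [X in _ + X](_ : _ = \sum_i (excess true (x ord0 i) + excess false (x ord0 i)) / n%:R).
  by rewrite -mulr_suml subrK.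
transitivity (\sum_i \sum_b spread x (Some (i, b))).
  by rewrite pair_bigA; apply: eq_big => [j|[]]; first exact: eqxx.
by apply: eq_bigr => i _; rewrite big_bool mulrDl.
Qed.

Lemma spread_ge0 x v : `|x| <= 1 -> 0 <= spread x v.
Proof.
move=> x1; case: v => [[i b]|] /=; first by rewrite divr_ge0 ?excess_ge0.
rewrite subr_ge0 ler_pdivrMr // mul1r.
apply: le_trans (ler_sum _ (G := fun=> 1) _) _.
  by move=> i _; apply: excess_sum; exact: le_trans (coord_le_norm _ _) x1.
by rewrite sumr_const card_ord.
Qed.

Lemma spread_lipschitz v x y : `|spread x v - spread y v| <= `|x - y|.
Proof.
have xy i : `|x ord0 i - y ord0 i| <= `|x - y|.
  by have := coord_le_norm (x - y) i; rewrite !mxE.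
case: v => [[i b]|] /=.
  rewrite -mulrBl normrM (gtr0_norm (_ : 0 < n%:R^-1)) ?invr_gt0 // ler_pdivrMr //.
  apply: le_trans ((excess_lipschitz _ _).2 b) _; apply: le_trans (xy i) _.
  by rewrite ler_peMr // ler1n.
rewrite opprB addrC addrA subrK -mulrBl -sumrB normrM.
rewrite (gtr0_norm (_ : 0 < n%:R^-1)) ?invr_gt0 // ler_pdivrMr //.
apply: le_trans (ler_norm_sum _ _ _) _.
apply: le_trans (ler_sum _ (G := fun=> `|x - y|) _) _.
  move=> i _; rewrite distrC; apply: le_trans (excess_lipschitz _ _).1 _; exact: xy.
by rewrite sumr_const card_ord mulr_natr.
Qed.

Lemma spread_inj x y : (forall v, spread x v = spread y v) -> `|x - y| <= 2 * r.
Proof.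
move=> H; apply/rV_norm_leP => [|i]; first by rewrite mulr_ge0 // ltW.
rewrite !mxE; apply: excess_inj => b; have /= := H (Some (i, b)).
by move/divIf; apply; rewrite gt_eqF.
Qed.

Definition spread_support x : {fset option ('I_n * bool)} :=
  [fset v in enum {: option ('I_n * bool)} | spread x v != 0]%fset.

(** Each coordinate larger than [r] in absolute value contributes only the vertex of its sign; the
    extra 1 is for [None]. *)
Lemma card_spread_support x :
  (#|` spread_support x| <= #|[set i : 'I_n | (r < `|x ord0 i|)%R]%SET|.+1)%N.
Proof.
set S := [set i | _]%SET.
pose e := None :: [seq Some (i, 0 < x ord0 i) | i <- enum S].
have -> : #|S|.+1 = size e by rewrite /= size_map -cardE.
apply: uniq_leq_size => // v; rewrite !inE /= => /andP[_].
case: v => [[i b]|//] /= H.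
have [xi ->] : r < `|x ord0 i| /\ b = (0 < x ord0 i).
  by apply: excess_neq0; apply: contraNneq H => ->; rewrite mul0r.
by apply/mapP; exists i => //; rewrite mem_enum inE.
Qed.
End soft_threshold.

(** The embedding is [spread] with [r = eps / 2]: its fibres have diameter at most [2 * r], and at
    most [m] large coordinates give at most [m.+1] vertices. *)
Lemma lp_ball_embeds (R : realType) (n m : nat) (p eps : R) :
  1 <= p -> (0 < n)%N -> 0 < eps -> (m <= n)%N ->
  m = n \/ 2 * m.+1%:R `^ (- p^-1) <= eps ->
  eps_embeds_in_dim (lp_ball_linfty n p) eps m.
Proof.
move=> p1 n0 eps0 mn Hm.
pose r := eps / 2.
have r0 : 0 < r by rewrite divr_gt0.
pose T : finType := option ('I_n * bool).
pose K := skeleton_complex T m.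
have ball_le1 (x : 'rV[R]_n) : lp_ball p x -> `|x| <= 1.
  by move=> Bx; apply/rV_norm_leP => // i; exact: lp_ball_coord_le1 Bx.
have cardS (x : 'rV[R]_n) : lp_ball p x ->
    (#|[set i : 'I_n | (r < `|x ord0 i|)%R]%SET| <= m)%N.
  move=> Bx; case: Hm => [->|mr].
    by rewrite -[X in (_ <= X)%N]card_ord max_card.
  by apply: (card_large_coords p1 Bx); rewrite ler_pdivlMr // mulrC.
have suppP (x : 'rV[R]_n) : lp_ball p x ->
    exists2 s, K s & closed_simplex s (spread r x : T -> R).
  move=> Bx; exists (spread_support r x).
    split; last by rewrite (leq_trans (card_spread_support _ _)) // ltnS cardS.
    apply/eqP => s0; have := sum_spread r x; rewrite big1 ?(eqTleqif) => [/esym/eqP|v _].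
      by rewrite oner_eq0.
    apply/eqP; rewrite -[_ == _]negbK; apply/negP => xv.
    have : v \in spread_support r x by rewrite !inE mem_enum.
    by rewrite s0.
  split => [v|v|]; first exact: spread_ge0 (ball_le1 _ Bx).
    by rewrite !inE mem_enum /= negbK => /eqP.
  rewrite -[RHS](sum_spread r x).
  transitivity (\sum_(v <- [fset v in enum T]%fset) spread r x v).
    apply: big_fset_incl; first by apply/fsubsetP => v; rewrite !inE => /andP[].
    by move=> v _; rewrite !inE mem_enum /= negbK => /eqP.
  rewrite -big_enum; apply: perm_big; apply: uniq_perm; rewrite ?enum_uniq //.
  by move=> v; rewrite !inE.
pose f (x : lp_ball_linfty n p) : polyhedron R K :=
  Polyhedron (suppP (set_val x) (set_mem (valP x))).
exists T, K, f; split; first by apply: skeleton_complex_dim; rewrite card_option card_prod card_ord card_bool; lia.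
split.
  apply: (continuous_to_polyhedron (s0 := [fset v in enum T]%fset)).
    by move=> x v; rewrite !inE mem_enum.
  move=> v; apply: (@lipschitz1_continuous R _ 'rV[R]_n R^o set_val (fun x => spread r x v)).
    exact: initial_continuous.
  by move=> x y; apply: spread_lipschitz.
move=> y; apply: ge_ereal_sup => _ [->|[x1 fx1 [x2 fx2 <-]]]; first by rewrite lee_fin ltW.
rewrite lee_fin -[leLHS]/(`|set_val x1 - set_val x2|).
have -> : eps = 2 * r by rewrite /r mulrC divfK.
apply: spread_inj => // v.
by have /(congr1 (fun z : polyhedron R K => z v)) : f x1 = f x2 by rewrite fx1 fx2.
Qed.

(** * The values of the width dimension and the spectrum *)

Lemma wdim_eq (R : realType) (X : metricType R) (eps : R) (k : nat) :
  eps_embeds_in_dim X eps k -> (forall j, eps_embeds_in_dim X eps j -> (k <= j)%N) ->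
  wdim X eps = k%:E.
Proof.
move=> Ek kmin; rewrite /wdim; case: pselect => [exk|[]]; last by exists k; apply/asboolP.
case: ex_minnP => j /asboolP Ej jmin; congr (_%:E); apply/eqP.
by rewrite eqn_leq kmin // andbT; apply: jmin; apply/asboolP.
Qed.

Lemma wdim_le (R : realType) (X : metricType R) (eps : R) (k : nat) :
  eps_embeds_in_dim X eps k -> exists2 j : nat, (j <= k)%N & wdim X eps = j%:E.
Proof.
move=> Ek; rewrite /wdim; case: pselect => [exk|[]]; last by exists k; apply/asboolP.
by case: ex_minnP => j _ jmin; exists j => //; apply: jmin; apply/asboolP.
Qed.

Theorem proposition1p3 (R : realType) (n : nat) (p : R)
    (n_ge1 : (1 <= n)%N) (p_ge1 : 1 <= p) :
  wspec (lp_ball_linfty n p) = [set k%:E | k in [set k : nat | (k <= n)%N]] /\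
  forall eps : R, 0 < eps ->
    [/\ 2 <= eps -> wdim (lp_ball_linfty n p) eps = 0%N%:E,
        forall k : nat, (1 <= k <= n.-1)%N ->
          2 * (k.+1%:R `^ (- p^-1)) <= eps < 2 * (k%:R `^ (- p^-1)) ->
          wdim (lp_ball_linfty n p) eps = k%:E
      & eps < 2 * (n%:R `^ (- p^-1)) ->
          wdim (lp_ball_linfty n p) eps = n%:E].
Proof.
have [p0 n0] : 0 < p /\ (0 < n)%N by split => //; exact: lt_le_trans p_ge1.
have main (eps : R) : 0 < eps ->
    [/\ 2 <= eps -> wdim (lp_ball_linfty n p) eps = 0%N%:E,
        forall k : nat, (1 <= k <= n.-1)%N ->
          2 * (k.+1%:R `^ (- p^-1)) <= eps < 2 * (k%:R `^ (- p^-1)) ->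
          wdim (lp_ball_linfty n p) eps = k%:E
      & eps < 2 * (n%:R `^ (- p^-1)) ->
          wdim (lp_ball_linfty n p) eps = n%:E].
  move=> eps0; split=> [eps2|k /andP[k1 kn] /andP[e1 e2]|en].
  - apply: wdim_eq => //; apply: lp_ball_embeds => //; right.
    by rewrite powR1 mulr1.
  - have kn' : (k <= n)%N by lia.
    apply: wdim_eq => [|j]; first by apply: lp_ball_embeds => //; right.
    (* The lower bound is stated for a cube of dimension [k.+1], so it is applied to the predecessor
       of [k]. *)
    by case: k k1 {kn e1} kn' e2 => // k _ kn' e2; exact: lp_ball_embedding_dim_gt.
  - apply: wdim_eq => [|j]; first by apply: lp_ball_embeds => //; left.
    rewrite -(prednK n0) in en *; apply: lp_ball_embedding_dim_gt => //.
split => //; apply/seteqP; split => [_ [eps /= eps0 <-]|_ [k /= kn <-]].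
  have [j jn ->] : exists2 j : nat, (j <= n)%N & wdim (lp_ball_linfty n p) eps = j%:E.
    by apply: wdim_le; apply: lp_ball_embeds => //; left.
  by exists j.
have [->|k0] := posnP k.
  have [H _ _] := main _ (ltr0Sn R 1); exists 2%:R; first exact: ltr0Sn.
  exact: H.
have q0 (j : nat) : 0 < 2 * j.+1%:R `^ (- p^-1) :> R by rewrite mulr_gt0 // powR_gt0.
have qlt (j : nat) : (0 < j)%N -> 2 * j.+1%:R `^ (- p^-1) < 2 * j%:R `^ (- p^-1) :> R.
  move=> j0; rewrite ltr_pM2l // !powRN ltf_pV2 ?posrE ?powR_gt0 ?ltr0n //.
  by apply: gt0_ltr_powR; rewrite ?invr_gt0 ?nnegrE ?ltr_nat.
exists (2 * k.+1%:R `^ (- p^-1)); first exact: q0.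
have [_ Hk Hn] := main _ (q0 k).
move: kn; rewrite leq_eqVlt => /predU1P[kE|kn]; first by subst k; apply: Hn; exact: qlt.
by apply: Hk; [lia|rewrite lexx qlt].
Qed.
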